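(* Let $G$ be a finite simple graph and let $m\geq 1$ be an integer. Then $c(\mathsf{M}_m(G))\geq 1$ if and only if $G$ is not bipartite.
   Context: Graphs are finite, without loops or multiple edges. A cover graph is the underlying undirected graph of the Hasse diagram (covering relation) of a finite partially ordered set. $c(G)=\min\{|F| : F\subseteq E(G) \text{ and } G-F \text{ is a cover graph}\}$, where $G-F$ is obtained by deleting the edges in $F$ (keeping all vertices). Generalized Mycielski graph: let $G$ have vertex set $V_0=\{\langle 0,0\rangle,\langle 0,1\rangle,\ldots,\langle 0,n-1\rangle\}$ and edge set $E_0$. For an integer $m>0$, $\mathsf{M}_m(G)$ has vertex set $V_0\cup\bigcup_{i=1}^m V_i\cup\{u\}$, where $V_i=\{\langle i,j\rangle : 0\leq j\leq n-1\}$, and edge set $E_0\cup\bigcup_{i=1}^m E_i\cup\{\langle m,j\rangle u : 0\leq j\leq n-1\}$, where $E_i=\{\langle i-1,j\rangle\langle i,k\rangle : \langle 0,j\rangle\langle 0,k\rangle\in E_0\}$ for $1\leq i\leq m$ (for each edge of $E_0$ both orders of $j,k$ are used). *)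

(* Defs.v *)
From HB Require Import structures.
From mathcomp Require Import all_boot all_order.
From mathcomp Require Import boolp.

Set Implicit Arguments.
Unset Strict Implicit.
Unset Printing Implicit Defensive.

Import Order.TTheory.

Record sgraph := SGraph {
  vertex :> finType;
  edge : rel vertex;
  edge_sym : symmetric edge;
  edge_irrefl : irreflexive edge }.

Definition edge_set (G : sgraph) : {set {set G}} :=
  [set [set p.1; p.2] | p : G * G & edge p.1 p.2].

Section DeleteEdges.
Variables (G : sgraph) (F : {set {set G}}).

Definition del_rel : rel G := fun x y => edge x y && ([set x; y] \notin F).

Lemma del_sym : symmetric del_rel.
Proof. by move=> x y; rewrite /del_rel edge_sym setUC. Qed.

Lemma del_irrefl : irreflexive del_rel.
Proof. by move=> x; rewrite /del_rel edge_irrefl. Qed.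

Definition del_edges : sgraph := SGraph del_sym del_irrefl.
End DeleteEdges.

Definition covered_by (d : Order.disp_t) (P : finPOrderType d) (x y : P) : bool :=
  (x < y)%O && [forall z : P, ~~ (x < z < y)%O].

(* The bijection [f] identifies the vertices of [G] with the elements of [P]. *)
Definition is_cover_graph (G : sgraph) : Prop :=
  exists (d : Order.disp_t) (P : finPOrderType d) (f : G -> P),
    bijective f /\
    forall x y : G,
      edge x y = covered_by (f x) (f y) || covered_by (f y) (f x).

Definition is_bipartite (G : sgraph) : Prop :=
  exists A : {set G}, forall x y : G, edge x y -> (x \in A) != (y \in A).

Definition deletable (G : sgraph) (k : nat) : bool :=
  [exists F : {set {set G}},
    [&& F \subset edge_set G, #|F| == k & `[< is_cover_graph (del_edges F) >]]].

(* Deleting every edge leaves the cover graph of an antichain, so the minimum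
   below is taken over a nonempty set. *)
Lemma deletable_ex (G : sgraph) : exists k, deletable G k.
Proof.
exists #|edge_set G|; apply/existsP; exists (edge_set G).
rewrite subxx eqxx /=; apply/asboolP.
have anti : antisymmetric (@eq_op G) by move=> x y /andP[/eqP].
have trans : transitive (@eq_op G) by move=> y x z /eqP ->.
pose mix := Order.Le_isPOrder.Build (Order.Disp tt tt) G (@eqxx G) anti trans.
pose P : finPOrderType (Order.Disp tt tt) := HB.pack (vertex G) mix.
exists (Order.Disp tt tt), P, (fun x => x).
split; first by exists (fun x => x).
have noc (a b : P) : covered_by a b = false.
  by rewrite /covered_by lt_neqAle [(a <= b)%O]/(@eq_op G a b) andNb.
move=> x y; rewrite !noc /edge /= /del_rel.
apply/negP => /andP[xy /negP[]].
by apply/imsetP; exists (x, y); rewrite ?inE.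
Qed.

Definition cover_distance (G : sgraph) : nat := ex_minn (deletable_ex G).

Section Mycielski.
Variables (m : nat) (G : sgraph).

(* [Some (i, x)] is the copy of [x] at level [i], with [0 <= i <= m], and
   [None] is the apex [u]. *)
Definition mycielski_rel : rel (option ('I_m.+1 * G)) := fun a b =>
  match a, b with
  | Some (i, x), Some (j, y) =>
      edge x y && [|| (i == 0 :> nat) && (j == 0 :> nat),
                      j == i.+1 :> nat | i == j.+1 :> nat]
  | Some (i, _), None | None, Some (i, _) => i == m :> nat
  | None, None => false
  end.

Lemma mycielski_sym : symmetric mycielski_rel.
Proof.
move=> [[i x]|] [[j y]|] //=; rewrite edge_sym; congr andb.
by rewrite andbC [X in _ || X]orbC.
Qed.

Lemma mycielski_irrefl : irreflexive mycielski_rel.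
Proof. by move=> [[i x]|] //=; rewrite edge_irrefl. Qed.

Definition mycielski : sgraph := SGraph mycielski_sym mycielski_irrefl.
End Mycielski.

(* Main.v *)
(** A cover graph carries a sign [s a b = 1] or [-1] on each oriented edge,
    according to whether [b] covers [a] or [a] covers [b]; neither an oriented
    cycle nor a chain closed up by a covering pair is possible, so the signs along
    every closed walk of length 4 add up to 0.  Write [a_i x y] for the sign from
    the copy of [x] at level [i] to the copy of [y] at level [i - 1] (at level 0
    when [i = 0]).  The 4-walks through the apex give
    [a_m x y = b x + q y] on the edges of [G], and the 4-walks through three
    consecutive levels pass this shape down to [a_0].  Since [a_0] is
    antisymmetric, [2 a_0 x y = d x - d y] with [d = b - q], so [d] changes by
    exactly 2 along each edge of [G] and its residue modulo 4 2-colours [G].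

    Conversely, if [G] is bipartite, then its generalized Mycielski graph is
    triangle-free and 3-colourable, and orienting its edges by increasing colour
    gives a Hasse diagram. *)
Require Import Defs.
From mathcomp Require Import all_boot.
From HB Require Import structures.
From mathcomp Require Import all_order ssralg ssrnum ssrint intdiv boolp zify.

Set Implicit Arguments.
Unset Strict Implicit.
Unset Printing Implicit Defensive.

Import Order.TTheory GRing.Theory.

Lemma deletable0 (G : sgraph) : deletable G 0 <-> is_cover_graph G.
Proof.
have e0 (x y : G) : del_rel set0 x y = edge x y by rewrite /del_rel inE andbT.
split=> [/existsP[F /and3P[_ /eqP/cards0_eq -> /asboolP]]|].
  by move=> [d [P [f [bij_f edgeP]]]]; exists d, P, f; split=> // x y; rewrite -e0 -edgeP.
move=> [d [P [f [bij_f edgeP]]]]; apply/existsP; exists set0.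
rewrite sub0set cards0 eqxx; apply/asboolP; exists d, P, f; split=> // x y.
by rewrite -edgeP; exact: e0.
Qed.

Lemma cover_distance_gt0 (G : sgraph) :
  0 < cover_distance G <-> ~ is_cover_graph G.
Proof.
rewrite /cover_distance; case: ex_minnP => k delk kmin; split.
  by move=> k0 /deletable0 /kmin; rewrite leqNgt k0.
by case: k delk {kmin} => // /deletable0.
Qed.

(** * Triangle-free 3-colourable graphs are cover graphs *)

Section ThreeColouring.
Variables (G : sgraph) (c : G -> nat).
Hypothesis c_le2 : forall x, c x <= 2.
Hypothesis c_proper : forall x y : G, edge x y -> c x != c y.
Hypothesis triangle_free : forall x y z : G, edge x y -> edge y z -> ~~ edge x z.

(** With colours at most 2 an increasing path has at most two edges, so this is already the
    transitive closure of the orientation by colour. *)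
Definition colour_lt (x y : G) : bool :=
  (c x < c y) &&
  (edge x y || [exists z, [&& edge x z, edge z y & c x < c z < c y]]).

Definition colour_le (x y : G) : bool := (x == y) || colour_lt x y.

Lemma colour_lt_trans : transitive colour_lt.
Proof.
move=> y x z /andP[xy exy] /andP[yz eyz].
rewrite /colour_lt (ltn_trans xy yz) /=; apply/orP; right.
apply/existsP; exists y; rewrite xy yz andbT.
have := c_le2 z => cz.
case/orP: exy => [->|/existsP[t /and3P[_ _ /andP[? ?]]]]; last by lia.
by case/orP: eyz => [->//|/existsP[t /and3P[_ _ /andP[? ?]]]]; lia.
Qed.

Lemma colour_le_refl : reflexive colour_le.
Proof. by move=> x; rewrite /colour_le eqxx. Qed.

Lemma colour_le_anti : antisymmetric colour_le.
Proof.
move=> x y /andP[/orP[/eqP//|/andP[xy _]] /orP[/eqP//|/andP[yx _]]].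
by have := ltn_trans xy yx; rewrite ltnn.
Qed.

Lemma colour_le_trans : transitive colour_le.
Proof.
move=> y x z /orP[/eqP->//|xy] /orP[/eqP<-|yz]; apply/orP; right=> //.
exact: colour_lt_trans yz.
Qed.

(** A pair related only through a middle vertex is not a covering pair, and an edge bypassed by a
    middle vertex would lie in a triangle. *)
Lemma three_colourable_cover : is_cover_graph G.
Proof.
pose mix := Order.Le_isPOrder.Build (Order.Disp tt tt) G
  colour_le_refl colour_le_anti colour_le_trans.
pose P : finPOrderType (Order.Disp tt tt) := HB.pack (vertex G) mix.
exists (Order.Disp tt tt), P, (fun x => x); split; first by exists id.
have ltE (x y : P) : (x < y)%O = colour_lt x y.
  rewrite lt_neqAle [(x <= y)%O]/(colour_le x y) /colour_le.
  by case: eqVneq => //= ->; rewrite /colour_lt ltnn.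
have coverE (x y : P) : covered_by x y = (c x < c y) && edge x y.
  apply/andP/andP => [[]|[xy exy]].
    rewrite ltE => /andP[xy /orP[exy //|/existsP[z /and3P[xz zy /andP[xz' zy']]]]].
    by move=> /forallP /(_ z); rewrite !ltE /colour_lt xz' zy' xz zy.
  rewrite ltE /colour_lt xy exy; split=> //; apply/forallP=> z; rewrite !ltE.
  apply/negP=> /andP[/andP[xz exz] /andP[zy ezy]]; have cy := c_le2 y.
  case/orP: exz => [exz|/existsP[t /and3P[_ _ /andP[? ?]]]]; last by lia.
  case/orP: ezy => [ezy|/existsP[t /and3P[_ _ /andP[? ?]]]]; last by lia.
  by have := triangle_free exz ezy; rewrite exy.
move=> x y; rewrite !coverE (edge_sym y x) -andb_orl -neq_ltn.
by case: (boolP (edge x y)) => [/c_proper ->|]; rewrite ?andbF.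
Qed.

End ThreeColouring.

Lemma bipartite_mycielski_cover (G : sgraph) (m : nat) :
  0 < m -> is_bipartite G -> is_cover_graph (mycielski m G).
Proof.
move=> m_gt0 [A bipA].
pose c (a : mycielski m G) := if a is Some (_, x) then nat_of_bool (x \in A) else 2.
apply: (@three_colourable_cover (mycielski m G) c).
- by move=> [[i x]|] //=; case: (x \in A).
- move=> [[i x]|] [[j y]|] //=; first by case/andP=> /bipA; do 2 case: (_ \in A).
    by case: (x \in A).
  by case: (y \in A).
- move=> [[i x]|] [[j y]|] [[k z]|] //=.
  + move=> /andP[/bipA xy _] /andP[/bipA yz _]; apply/negP=> /andP[/bipA xz _].
    by move: xy yz xz; do 3 case: (_ \in A).
  (* A triangle through the apex needs an edge inside level [m]; only level 0 has such edges, and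
     [0 < m]. *)
  + by move=> /andP[_ ij] /eqP jm; apply/negP=> /eqP im; lia.
  + by move=> /eqP im /eqP km; rewrite negb_and; apply/orP; right; lia.
  + by move=> /eqP jm /andP[_ jk]; apply/negP=> /eqP km; lia.
Qed.

(** * Signs along closed walks in a Hasse diagram *)

Local Open Scope ring_scope.

Section CoverSign.
Variables (d : Order.disp_t) (P : finPOrderType d).

Definition cover_sign (a b : P) : int := if covered_by a b then 1 else -1.

Definition cover_adj (a b : P) : bool := covered_by a b || covered_by b a.

Lemma covered_by_lt (a b : P) : covered_by a b -> (a < b)%O.
Proof. by case/andP. Qed.

Lemma cover_sign_opp (a b : P) : cover_adj a b -> cover_sign b a = - cover_sign a b.
Proof.
rewrite /cover_sign => /orP[] ab; rewrite ab; case: ifP => // /covered_by_lt ba;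
  by have := lt_trans ba (covered_by_lt ab); rewrite ltxx.
Qed.

Lemma chain3_not_adj (a b c e : P) :
  covered_by a b -> covered_by b c -> covered_by c e -> cover_adj e a -> False.
Proof.
move=> /covered_by_lt ab /covered_by_lt bc /covered_by_lt ce.
have be := lt_trans bc ce.
case/orP=> [/covered_by_lt ea|/andP[_ /forallP /(_ b)]]; last by rewrite ab be.
by have := lt_trans (lt_trans ab be) ea; rewrite ltxx.
Qed.

Lemma cover_sign_walk4 (a b c e : P) :
  cover_adj a b -> cover_adj b c -> cover_adj c e -> cover_adj e a ->
  cover_sign a b + cover_sign b c + cover_sign c e + cover_sign e a = 0.
Proof.
have adjC (x y : P) : cover_adj x y -> cover_adj y x by rewrite /cover_adj orbC.
have revP (x y : P) : cover_adj x y -> covered_by x y = false -> covered_by y x.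
  by rewrite /cover_adj => + xy; rewrite xy.
move=> ab bc ce ea; rewrite /cover_sign.
case: ifP => [|/(revP _ _ ab)] hab; case: ifP => [|/(revP _ _ bc)] hbc;
  case: ifP => [|/(revP _ _ ce)] hce; case: ifP => [|/(revP _ _ ea)] hea //.
(* In each unbalanced pattern three cyclically consecutive steps go the same way: up in the first
   four alternatives below, down in the last four. *)
all: exfalso.
all: by [ apply: (chain3_not_adj hab hbc hce) | apply: (chain3_not_adj hbc hce hea)
  | apply: (chain3_not_adj hce hea hab) | apply: (chain3_not_adj hea hab hbc)
  | apply: (chain3_not_adj hce hbc hab); exact: adjC
  | apply: (chain3_not_adj hea hce hbc); exact: adjC
  | apply: (chain3_not_adj hab hea hce); exact: adjC
  | apply: (chain3_not_adj hbc hab hea); exact: adjC ].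
Qed.

End CoverSign.

(** * Splitting the signs and passing down the levels *)

Definition splits (G : sgraph) (a : G -> G -> int) : Prop :=
  exists b q : G -> int, forall x y, edge x y -> a x y = b x + q y.

Lemma splits_of_const (G : sgraph) (a : G -> G -> int) (b : G -> int) :
  (forall x y z, edge x y -> edge y z -> a x y - b x = a z y - b z) -> splits a.
Proof.
move=> const.
(* The value at [y] is read off at any neighbour; the default 0 occurs only at isolated vertices. *)
exists b, (fun y => if [pick x | edge x y] is Some x then a x y - b x else 0).
move=> x y xy; case: pickP => [z zy|/(_ x)]; last by rewrite xy.
have yz : edge y z by rewrite edge_sym.
by have := const x y z xy yz; lia.
Qed.

(** Substituting [b + q] for [a] cancels [b y], so [a' x y + q x] is the same for all neighbours [x]
    of [y]. *)
Lemma splits_transfer (G : sgraph) (a a' : G -> G -> int) :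
  splits a ->
  (forall x y z, edge x y -> edge y z -> a y z + a' z y = a y x + a' x y) ->
  splits a'.
Proof.
move=> [b [q aE]] trans; apply: (@splits_of_const G a' (fun x => - q x)) => x y z xy yz.
have yx : edge y x by rewrite edge_sym.
by have := trans x y z xy yz; rewrite (aE _ _ yz) (aE _ _ yx); lia.
Qed.

Lemma splits_antisym_bipartite (G : sgraph) (a : G -> G -> int) :
  splits a ->
  (forall x y, edge x y -> a y x = - a x y) ->
  (forall x y, edge x y -> a x y = 1 \/ a x y = -1) ->
  is_bipartite G.
Proof.
move=> [b [q aE]] anti unit.
(* A change by 2 modulo 4 swaps the residues 0, 1 with 2, 3. *)
exists [set x | ((b x - q x) %% 4)%Z < 2] => x y xy; rewrite !inE.
have yx : edge y x by rewrite edge_sym.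
have := unit x y xy; have := anti x y xy; rewrite (aE _ _ xy) (aE _ _ yx).
by move=> ? ?; lia.
Qed.

Lemma cover_mycielski_bipartite (G : sgraph) (m : nat) :
  is_cover_graph (mycielski m G) -> is_bipartite G.
Proof.
move=> [d [P [f [_ edgeP]]]].
pose s (v w : mycielski m G) := cover_sign (f v) (f w).
have s_opp (v w : mycielski m G) : edge v w -> s w v = - s v w.
  by rewrite edgeP; exact: cover_sign_opp.
have s_walk4 (v w t r : mycielski m G) :
    edge v w -> edge w t -> edge t r -> edge r v -> s v w + s w t + s t r + s r v = 0.
  by rewrite !edgeP; exact: cover_sign_walk4.
pose lev (i : nat) (x : G) : mycielski m G := Some (inord i, x).
(* As [0.-1 = 0], this also covers the edges inside level 0. *)
have edge_lev (i : nat) (x y : G) : (i <= m)%N -> edge x y -> edge (lev i x) (lev i.-1 y).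
  move=> im xy; rewrite /edge /= xy !inordK ?ltnS //; last exact: leq_trans (leq_pred i) im.
  by case: i im => //= i _; rewrite eqxx orbT.
have edge_lev' (i : nat) (x y : G) : (i <= m)%N -> edge x y -> edge (lev i.-1 x) (lev i y).
  by move=> im xy; rewrite edge_sym edge_lev // edge_sym.
have edge_top (x : G) : edge (lev m x) (None : mycielski m G).
  by rewrite /edge /= inordK.
pose a (i : nat) (x y : G) := s (lev i x) (lev i.-1 y).
have split_a (k : nat) : (k <= m)%N -> splits (a (m - k)%N).
  elim: k => [_|k IHk km].
    rewrite subn0; apply: (@splits_of_const G _ (fun x => s (lev m x) None)) => x y z xy yz.
    have top_x : edge (None : mycielski m G) (lev m x) by rewrite edge_sym.
    have := s_walk4 _ _ _ _ (edge_lev m x y (leqnn m) xy) (edge_lev' m y z (leqnn m) yz)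
      (edge_top z) top_x.
    have zy : edge z y by rewrite edge_sym.
    rewrite (s_opp _ _ (edge_lev m z y (leqnn m) zy)) (s_opp _ _ (edge_top x)) /a.
    by lia.
  have [i [imk im]] : exists i, (m - k = i.+1 /\ i.+1 <= m)%N by exists (m - k.+1)%N; lia.
  have -> : (m - k.+1 = i)%N by lia.
  apply: splits_transfer (IHk (ltnW km)) _; rewrite imk => x y z xy yz.
  have zy : edge z y by rewrite edge_sym.
  have yx : edge y x by rewrite edge_sym.
  have im' := ltnW im.
  (* The walk visits [x] at level [i], [y] at [i.+1], [z] at [i], [y] at [i.-1], and closes up. *)
  have := s_walk4 _ _ _ _ (edge_lev' i.+1 x y im xy) (edge_lev i.+1 y z im yz)
    (edge_lev i z y im' zy) (edge_lev' i y x im' yx).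
  rewrite (s_opp _ _ (edge_lev i.+1 y x im yx)) (s_opp _ _ (edge_lev i x y im' xy)) /a /=.
  by lia.
have := split_a m (leqnn m); rewrite subnn => split0.
apply: splits_antisym_bipartite split0 _ _ => x y xy.
  exact: s_opp (edge_lev 0 x y (leq0n m) xy).
by rewrite /a /s /cover_sign; case: ifP => _; [left|right].
Qed.

Local Close Scope ring_scope.

Theorem corollary7 (G : sgraph) (m : nat) (hm : 1 <= m) :
  1 <= cover_distance (mycielski m G) <-> ~ is_bipartite G.
Proof.
rewrite cover_distance_gt0; split=> not_cover.
  by move=> /(bipartite_mycielski_cover hm).
by move=> /cover_mycielski_bipartite.
Qed.
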